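(* Let $\alpha>0$ be fixed. As $Q\to\infty$, for all but $Q^{o(1)}$ primes $p\in[Q,2Q]$ we have $$M_\alpha^*(p)\le p^{2+o(1)}.$$
   Context: An integer $n$ is $y$-smooth if all prime divisors of $n$ do not exceed $y$; it is square-free if it is not divisible by the square of a prime. For a real $\alpha>0$ and an integer $q$, $M_\alpha^*(q)$ denotes the smallest integer $M$ such that every reduced residue class modulo $q$ (i.e. every class $a \bmod q$ with $\gcd(a,q)=1$) contains a $q^\alpha$-smooth square-free positive representative $k\le M$; $M_\alpha^*(q)=\infty$ if no such $M$ exists. Each $o(1)$ denotes a quantity tending to $0$ as $Q\to\infty$, possibly depending on $\alpha$; that is, for every $\delta,\kappa>0$ and all sufficiently large $Q$, the inequality $M_\alpha^*(p)\le p^{2+\delta}$ holds for all but at most $Q^{\kappa}$ primes $p\in[Q,2Q]$. *)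

(* Defs.v *)
From mathcomp Require Import all_boot all_order all_algebra.
From mathcomp Require Import all_classical all_reals all_analysis.

Set Implicit Arguments.
Unset Strict Implicit.
Unset Printing Implicit Defensive.

Import Order.TTheory GRing.Theory Num.Theory.
Import numFieldNormedType.Exports.

Local Open Scope ring_scope.

Definition smooth (R : realType) (y : R) (n : nat) : Prop :=
  forall p : nat, prime p -> (p %| n)%N -> p%:R <= y.

Definition squarefree (n : nat) : Prop :=
  forall p : nat, prime p -> ~~ (p ^ 2 %| n)%N.

Definition reaches_reduced_classes
    (R : realType) (alpha : R) (q M : nat) : Prop :=
  forall a : nat, coprime a q ->
    exists k : nat, [/\ (0 < k <= M)%N, k = a %[mod q],
                        smooth (q%:R `^ alpha) k & squarefree k].

Definition Mstar (R : realType) (alpha : R) (q : nat) : \bar R :=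
  match pselect (exists M, `[< reaches_reduced_classes alpha q M >]) with
  | left exM => (ex_minn exM)%:R%:E
  | right _ => +oo%E
  end.

(* The range of [p] only makes the count finite: [Num.truncn] is the integer
   part, so every natural [p <= 2 * Q] is below [(Num.truncn (2 * Q)).+1]. *)
Definition nb_exceptional (R : realType) (alpha delta Q : R) : nat :=
  size [seq p <- iota 0 (Num.truncn (2 * Q)).+1 |
    [&& prime p, Q <= p%:R <= 2 * Q &
        ~~ (Mstar alpha p <= (p%:R `^ (2 + delta))%:E)%E]].

(* Main.v *)
Require Import Defs.
From mathcomp Require Import all_boot all_order all_algebra.
From mathcomp Require Import all_classical all_reals all_analysis.
From mathcomp Require Import zify ring lra.

(** Let [X] be about [Q^(1/k)] with [1/k <= alpha, delta], and let [U], [V], [W]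
be disjoint sets of [t] primes up to [X], where [t] is of order [X / log X]. If a
class [a] mod [p] is missed by all [c * b * d], with [c] and [b] products of [k]
elements of [U] and [V], and [d] in [W], then the centred indicator function [f]
of the residues [b] satisfies [|Tf|^2 >= g |f|^2], where [Tf(x)] is the sum of
[f(x / d)] over [d] in [W] and [g] is at least [t^2] over a power of [log Q].
As [T] is normal, [|T^m f|^2 >= g^m |f|^2]. Now [|T^m f| / |f|] is a sum of
[h_p(n)] over products [n] of [m] elements of [W], where the correlation [h_p] is
[p]-periodic, bounded by 1 and of mean 0. For [p <> q] the function [h_p * h_q]
has mean 0 over a period [p * q], so the functions [h_p] are nearly orthogonal on
[[0, X^m]] for [m = 5k], and Cauchy-Schwarz leaves room for at most a power of
[log Q] exceptional [p]. *)

Set Implicit Arguments.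
Unset Strict Implicit.
Unset Printing Implicit Defensive.

Import Order.TTheory GRing.Theory Num.Theory.
Import numFieldNormedType.Exports.

(** * Primes and their products *)

(** By Legendre's formula the exponent is the sum over [i] of [2n %/ p^i - 2 (n %/ p^i)]. Each term
    is at most 1, and it vanishes once [p^i > 2n]. *)
Lemma logn_central_bin p n : prime p -> logn p 'C(n.*2, n) <= trunc_log p n.*2.
Proof.
move=> pr_p.
have [->|n_gt0] := posnP n; first by rewrite bin0 logn1.
have p1 := prime_gt1 pr_p.
have le_n : n <= n.*2 by rewrite -addnn leq_addr.
have /(congr1 (logn p)) := bin_fact le_n.
rewrite -addnn addnK !lognM ?muln_gt0 ?fact_gt0 ?bin_gt0 ?leq_addr //.
rewrite !logn_fact // => eqC.
set t := trunc_log p (n + n).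
suff h : \sum_(1 <= i < (n + n).+1) (n + n) %/ p ^ i <=
       (\sum_(1 <= i < (n + n).+1) n %/ p ^ i).*2 + t.
  have e : \sum_(1 <= i < (n + n).+1) n %/ p ^ i = \sum_(1 <= i < n.+1) n %/ p ^ i.
    rewrite (big_cat_nat _ (n := n.+1)) ?ltnS ?leq_addr //= [X in _ + X]big_nat_cond.
    rewrite [X in _ + X]big1 ?addn0 // => i /andP[/andP[ni _] _].
    by rewrite divn_small // (leq_trans ni) // ltnW // ltn_expl.
  by move: h; rewrite e -eqC; lia.
have tlt : t < n + n.
  rewrite -(@ltn_exp2l p) //; apply: leq_ltn_trans (ltn_expl _ p1).
  by apply: trunc_logP; rewrite // addn_gt0 n_gt0.
rewrite -mul2n big_distrr /=.
rewrite (big_cat_nat _ (n := t.+1)) ?ltnS ?(ltnW tlt) //=.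
rewrite [X in _ <= X + _](big_cat_nat _ (n := t.+1)) ?ltnS ?(ltnW tlt) //=.
rewrite [X in _ + X <= _]big_nat_cond [X in _ + X <= _]big1 ?addn0.
  rewrite addnAC; apply: leq_trans (leq_addr _ _).
  rewrite -[t in _ <= _ + t]muln1 -[t in _ <= _ + t * _](subn1 t.+1) -sum_nat_const_nat.
  rewrite -big_split /=.
  apply: leq_sum => i _.
  rewrite divnD ?expn_gt0 ?(ltnW p1) // mul2n -addnn leq_add2l.
  exact: leq_b1.
move=> i /andP[/andP[ti _] _].
rewrite divn_small //; apply: leq_trans (trunc_log_ltn _ p1) _.
by rewrite leq_exp2l.
Qed.

(** Since [(n+1) C(2n+2, n+1) = 2 (2n+1) C(2n, n)], each step multiplies by at least 2. *)
Lemma expn2_le_central_bin n : 2 ^ n <= 'C(n.*2, n).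
Proof.
elim: n => [|n IHn]; first by rewrite bin0.
have h : 'C(n.+1.*2, n.+1) * n.+1 = (n.*2.+1).*2 * 'C(n.*2, n).
  have /= diag := mul_bin_diag n.*2.+1 n.
  have sym : 'C(n.*2.+1, n) = 'C(n.*2.+1, n.+1).
    by rewrite -bin_sub -addnn ?subSn ?addnK ?leqW ?leq_addr.
  by rewrite doubleS binS sym addnn -doubleMl mulnC -diag doubleMl.
rewrite -(@leq_pmul2r n.+1) // h expnS; nia.
Qed.

(** A weak Chebyshev bound. With [n = X./2], the number [C(2n, n) >= 2^n] is a product of prime
    powers belonging to distinct primes up to [X], none exceeding [2n <= X]; comparing exponents of
    2 gives the claim. *)
Lemma leq_prime_count X :
  2 <= X -> X./2 <= (trunc_log 2 X).+1 * #|[set i : 'I_X.+1 | prime i]|.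
Proof.
move=> X2; set n := X./2; set P := [set _ | _].
have n2X : n.*2 <= X by rewrite /n; lia.
have n_gt0 : 0 < n.*2 by rewrite double_gt0 /n; lia.
clearbody n.
have C0 : 0 < 'C(n.*2, n) by rewrite bin_gt0 -addnn leq_addr.
have sz : size (primes 'C(n.*2, n)) <= #|P|.
  rewrite cardE -(size_map val); apply: uniq_leq_size (primes_uniq _) _ => p.
  rewrite mem_primes => /and3P[pr_p _ pC].
  have lpX : p <= X.
    apply: leq_trans n2X; have := logn_central_bin n pr_p.
    rewrite -{1}[p]expn1 pfactor_dvdn // in pC.
    move/(leq_trans pC); rewrite -(leq_exp2l _ _ (prime_gt1 pr_p)) expn1.
    by move/leq_trans; apply; apply: trunc_logP (prime_gt1 pr_p) n_gt0.
  have pX : p < X.+1 by [].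
  by apply/mapP; exists (Ordinal pX); rewrite ?mem_enum ?inE.
have le1 : 'C(n.*2, n) <= X ^ #|P|.
  rewrite [X in X <= _](prod_prime_decomp C0) prime_decompE big_map /=.
  apply: leq_trans (_ : \prod_(p <- primes 'C(n.*2, n)) X <= _); last first.
    by rewrite big_const_seq iter_muln_1 count_predT leq_exp2l // ltnW.
  rewrite big_seq [leqRHS]big_seq.
  elim/big_ind2: _ => // [*|p]; first exact: leq_mul.
  rewrite mem_primes => /and3P[pr_p _ _].
  apply: leq_trans n2X.
  apply: leq_trans (trunc_logP (prime_gt1 pr_p) n_gt0).
  by rewrite leq_exp2l ?prime_gt1 // logn_central_bin.
rewrite -(@leq_exp2l 2) // expnM.
apply: leq_trans (expn2_le_central_bin n) _; apply: leq_trans le1 _.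
have [->|P_gt0] := posnP #|P|; first by rewrite !expn0.
by rewrite leq_exp2r // ltnW // trunc_log_ltn.
Qed.

(** The falling factorial [k! C(T, k)] has [k] factors, each at least [T / 2]. *)
Lemma leq_expn_bin T k : k.*2 <= T -> T ^ k <= 2 ^ k * (k`! * 'C(T, k)).
Proof.
move=> kT; rewrite mulnC [k`! * _]mulnC bin_ffact ffact_prod.
rewrite -[X in T ^ X]card_ord -[X in 2 ^ X]card_ord -!prod_nat_const -big_split.
by apply: leq_prod => i _ /=; have := ltn_ord i; lia.
Qed.

Lemma exists_subset_card (I : finType) (P : {set I}) t :
  t <= #|P| -> exists2 A : {set I}, A \subset P & #|A| = t.
Proof.
rewrite -bin_gt0 -cards_draws => /card_gt0P[A]; rewrite inE => /andP[AP /eqP cA].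
by exists A.
Qed.

Lemma exists_three_subsets (I : finType) (P : {set I}) t :
  3 * t <= #|P| -> exists U : 'I_3 -> {set I},
    (forall i, U i \subset P /\ #|U i| = t) /\
    (forall i j, i != j -> [disjoint U i & U j]).
Proof.
move=> tP.
have [A AP cA] : exists2 A : {set I}, A \subset P & #|A| = t.
  by apply: exists_subset_card; lia.
have cPA : #|P :\: A| = #|P| - t by rewrite cardsDS ?cA.
have [B BP cB] : exists2 B : {set I}, B \subset P :\: A & #|B| = t.
  by apply: exists_subset_card; lia.
have cPAB : #|(P :\: A) :\: B| = #|P| - t - t by rewrite cardsDS ?cB ?cPA.
have [C CP cC] : exists2 C : {set I}, C \subset (P :\: A) :\: B & #|C| = t.
  by apply: exists_subset_card; lia.
move: BP CP; rewrite !subsetD => /andP[BP dBA] /andP[/andP[CP dCA] dCB].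
exists (fun i : 'I_3 => nth A [:: A; B; C] i); split.
  by case=> -[|[|[|i]]].
by case=> -[|[|[|i]]] // ? [] -[|[|[|j]]] // ? _ /=; rewrite // disjoint_sym.
Qed.

(** * Square-free products of sets of primes *)

Section ProductsOfPrimeSets.
Variable X : nat.
Implicit Types U V : {set 'I_X.+1}.

Definition set_prod U := \prod_(i in U) (i : nat).
Definition prime_set U := forall i, i \in U -> prime i.

Lemma set_prod_gt0 U : prime_set U -> 0 < set_prod U.
Proof. by move=> pU; apply: prodn_cond_gt0 => i /pU /prime_gt0. Qed.

Lemma set_prod_le U : set_prod U <= X ^ #|U|.
Proof.
by rewrite -prod_nat_const; apply: leq_prod => i _; rewrite -ltnS ltn_ord.
Qed.

Lemma prime_dvd_set_prod U p : prime p -> prime_set U -> p %| set_prod U ->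
  exists2 i, i \in U & p = i.
Proof.
move=> pr_p pU; rewrite /set_prod Euclid_dvd_prod // big_has_cond => /hasP[i _ /andP[iU]].
by rewrite dvdn_prime2 ?pU // => /eqP; exists i.
Qed.

Lemma dvd_set_prod U (i : 'I_X.+1) : prime_set U -> prime i -> (i %| set_prod U) = (i \in U).
Proof.
move=> pU pr_i; apply/idP/idP => [|iU].
  by case/(prime_dvd_set_prod pr_i pU) => j jU /val_inj ->.
by rewrite /set_prod (bigD1 i) //= dvdn_mulr.
Qed.

Lemma set_prod_inj U V : prime_set U -> prime_set V ->
  set_prod U = set_prod V -> U = V.
Proof.
move=> pU pV eqUV; apply/setP => i; apply/idP/idP => iW.
  by rewrite -dvd_set_prod ?(pU i) // -eqUV dvd_set_prod ?(pU i).
by rewrite -dvd_set_prod ?(pV i) // eqUV dvd_set_prod ?(pV i).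
Qed.

Lemma set_prodU U V : [disjoint U & V] ->
  set_prod (U :|: V) = set_prod U * set_prod V.
Proof.
by move=> dUV; rewrite /set_prod -(bigU _ _ _ dUV); apply: eq_bigl => i; rewrite !inE.
Qed.

Lemma set_prod_squarefree U p : prime_set U -> prime p -> ~~ (p ^ 2 %| set_prod U).
Proof.
move=> pU pr_p; apply/negP => p2U.
have [i iU pi] : exists2 i, i \in U & p = i.
  by apply: prime_dvd_set_prod => //; apply: dvdn_trans p2U; rewrite dvdn_exp.
subst p; move: p2U; rewrite /set_prod (bigD1 i) //= -mulnn dvdn_pmul2l ?prime_gt0 //.
have -> : \prod_(j in U | j != i) (j : nat) = set_prod (U :\ i).
  by apply: eq_bigl => j; rewrite !inE andbC.
rewrite dvd_set_prod ?inE ?eqxx // => j; rewrite !inE => /andP[_]; exact: pU.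
Qed.

End ProductsOfPrimeSets.

(** Repetitions are kept: there is one entry for each word of length [m], so that the list expands
    the [m]-th iterate of a dilation operator. *)
Fixpoint words (s : seq nat) m : seq nat :=
  if m is m'.+1 then [seq d * n | d <- s, n <- words s m'] else [:: 1].

Lemma size_words s m : size (words s m) = size s ^ m.
Proof. by elim: m => //= m IHm; rewrite size_allpairs IHm expnS. Qed.

Lemma words_le X s m n : (forall d, d \in s -> d <= X) ->
  n \in words s m -> n <= X ^ m.
Proof.
move=> sX; elim: m n => /= [|m IHm] n; first by rewrite inE => /eqP ->.
by move=> /allpairsP[[d n'] /= [ds n's ->]]; rewrite expnS leq_mul ?sX ?IHm.
Qed.

Section Multiplicity.
Variable s : seq nat.
Hypotheses (uniq_s : uniq s) (prime_s : forall d, d \in s -> prime d).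

(** A prime of [s] that divides a word is one of its [m] letters. *)
Lemma count_dvd_words m n : n \in words s m -> count (dvdn^~ n) s <= m.
Proof.
elim: m n => /= [|m IHm] n.
  rewrite inE leqn0 => /eqP ->; rewrite -leqn0 leqNgt -has_count.
  by apply/hasPn => d ds /=; rewrite dvdn1; have /prime_gt1 := prime_s ds; case: d {ds} => [|[]].
move=> /allpairsP[[d n'] /= [ds n's ->]].
have -> : count (dvdn^~ (d * n')) s = count (predU (pred1 d) (dvdn^~ n')) s.
  apply: eq_in_count => p ps /=.
  by rewrite Euclid_dvdM ?prime_s // dvdn_prime2 ?prime_s.
apply: leq_trans (leq_addr (count (predI (pred1 d) (dvdn^~ n')) s) _) _.
by rewrite count_predUI count_uniq_mem // ds add1n ltnS IHm.
Qed.

(* A word [d * n'] with product [n] is determined by the letter [d], for which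
   there are at most [m] choices, and by a shorter word with product [n %/ d]. *)
Lemma count_words m n : count_mem n (words s m) <= m`!.
Proof.
elim: m n => [|m IHm] n /=; first by case: eqP.
have [n_in|] := boolP (n \in words s m.+1); last by move/count_memPn => /= ->.
rewrite count_flatten -map_comp sumnE big_map /=.
apply: leq_trans (_ : \sum_(d <- s) (d %| n) * m`! <= _); last first.
  rewrite -big_distrl /= factS leq_mul2r; apply/orP; right.
  have -> : \sum_(d <- s) (d %| n) = count (dvdn^~ n) s.
    by rewrite -sum1_count [RHS]big_mkcond; apply: eq_bigr => d _; case: (d %| n).
  exact: count_dvd_words n_in.
rewrite big_seq [leqRHS]big_seq; apply: leq_sum => d ds /=.
have d_gt0 := prime_gt0 (prime_s ds).
rewrite count_map; case: (boolP (d %| n)) => [dn|ndn]; last first.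
  rewrite mul0n leqn0 -leqn0 leqNgt -has_count; apply: contra ndn.
  by case/hasP => n' _ /= /eqP <-; rewrite dvdn_mulr.
rewrite mul1n; apply: leq_trans (IHm (n %/ d)); apply: sub_count => n' /= /eqP <-.
by rewrite mulKn.
Qed.

End Multiplicity.

(** Dividing by 3 leaves room for three disjoint sets of primes. The Chebyshev bound first yields at
    least [6k] primes, which makes the rounding in [t] harmless: there are at most [5t] primes. *)
Lemma prime_count_third k X (t := #|[set i : 'I_X.+1 | prime i]| %/ 3) :
    (0 < k) -> (12 * k * (trunc_log 2 X).+1 + 1 < X) ->
  (k.*2 <= t) /\ (X <= 11 * (trunc_log 2 X).+1 * t).
Proof.
move=> k0 kX; have X2 : (2 <= X) by move: kX; nia.
have := leq_prime_count X2.
rewrite {}/t; set P := #|_|; set L := (trunc_log 2 X).+1 in kX *.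
have L0 : (0 < L) by [].
clearbody P L => hP.
have lP : (6 * k <= P).
  rewrite leqNgt; apply/negP => ?; have : (L * P <= L * (6 * k)) by rewrite leq_mul2l; lia.
  lia.
have t1 : (k.*2 <= P %/ 3) by lia.
split=> //; have : (P <= 5 * (P %/ 3)) by lia.
move: (P %/ 3) t1 => t t1 Pt.
have : (L * P <= L * (5 * t)) by rewrite leq_mul2l Pt orbT.
have : (1 <= L * t) by rewrite muln_gt0 L0; lia.
lia.
Qed.

(** The sieve error [e Y^2] is at most of order [X^(3k)], below [X^m]. Up to constants it remains to
    compare [e t^((2k+2)m)] with [t^m X^((2k+1)m)], and [X / t] is at most [11 L]. *)
Lemma polylog_bound k X Y L t e (m := (5 * k)) :
    (0 < k) -> (16 <= X) -> (0 < t) -> (k.*2 <= t) -> (X <= 11 * L * t) ->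
    (Y <= 2 ^ k.+1 * X ^ k) -> (e <= Y.+1) ->
    (e * ('C(t, k) * 'C(t, k) * t ^ 2) ^ m <=
     m`! * t ^ m * ((X ^ m).+1 + e * Y ^ 2) * (Y ^ 2) ^ m) ->
  (e <= 3 * m`! * (2 ^ k * k`!) ^ (2 * m) * (2 ^ k.+1) ^ (2 * m) *
        (11 * L) ^ ((2 * k + 1) * m)).
Proof.
move=> k0 X16 t0 kt Xt YX eY main.
have X0 : (0 < X) by lia.
(* Of the [5k] factors of [X^m], [3k] match [Y^3]; the other [2k], each at least 16, absorb the
   powers of 2. *)
have err : ((X ^ m).+1 + e * Y ^ 2 <= 3 * X ^ m).
  have h1 : (0 < X ^ m) by rewrite expn_gt0 X0.
  suff : (e * Y ^ 2 <= X ^ m) by lia.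
  have [->|Y0] := posnP Y; first by rewrite exp0n // muln0.
  apply: leq_trans (_ : 2 * Y ^ 3 <= _).
    rewrite [(Y ^ 3)]expnS mulnA leq_mul2r; apply/orP; right; lia.
  apply: leq_trans (_ : 2 * (2 ^ k.+1 * X ^ k) ^ 3 <= _).
    by rewrite leq_mul2l leq_exp2r // YX.
  have -> : (X ^ m = X ^ (2 * k) * (X ^ k) ^ 3).
    by rewrite -expnM -expnD; congr (_ ^ _); rewrite /m; lia.
  rewrite expnMn mulnA leq_mul2r; apply/orP; right.
  apply: leq_trans (_ : 16 ^ (2 * k) <= _); last by rewrite leq_exp2r // muln_gt0.
  by rewrite -expnM -expnS -[16]/(2 ^ 4) -expnM leq_exp2l //; lia.
have M0 : ((2 * k + 1) * m = 2 * k * m + m) by lia.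
suff : (e * t ^ ((2 * k + 1) * m) <= 3 * m`! * (2 ^ k * k`!) ^ (2 * m) *
    (2 ^ k.+1) ^ (2 * m) * (11 * L) ^ ((2 * k + 1) * m) * t ^ ((2 * k + 1) * m)).
  by rewrite leq_pmul2r // expn_gt0 t0.
rewrite -[X in (_ <= X)]mulnA -expnMn.
apply: leq_trans (_ : 3 * m`! * (2 ^ k * k`!) ^ (2 * m) *
    (2 ^ k.+1) ^ (2 * m) * X ^ ((2 * k + 1) * m) <= _); last first.
  by rewrite leq_mul2l leq_exp2r ?Xt ?orbT // muln_gt0 /m; lia.
have tm0 : (0 < t ^ m) by rewrite expn_gt0 t0.
rewrite -(leq_pmul2r tm0).
have bin : (t ^ k <= 2 ^ k * k`! * 'C(t, k)) by rewrite -mulnA leq_expn_bin.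
apply: leq_trans (_ : (2 ^ k * k`!) ^ (2 * m) *
    (e * ('C(t, k) * 'C(t, k) * t ^ 2) ^ m) <= _).
  apply: leq_trans (_ : e * (((2 ^ k * k`! * 'C(t, k)) ^ 2 * t ^ 2) ^ m) <= _).
    have -> : (e * t ^ ((2 * k + 1) * m) * t ^ m = e * (((t ^ k) ^ 2 * t ^ 2) ^ m)).
      rewrite -mulnA -expnD -expnM -expnD -expnM; congr (_ * _ ^ _); lia.
    rewrite leq_mul2l; apply/orP; right; rewrite leq_exp2r; last by rewrite /m; lia.
    by rewrite leq_mul2r leq_exp2r // bin orbT.
  rewrite [leqRHS]mulnCA leq_mul2l; apply/orP; right.
  rewrite [(_ * k`!) ^ (2 * m)]expnM -[leqRHS]expnMn eq_leq //; congr expn.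
  by rewrite !expnMn -!mulnn; ring.
apply: leq_trans (leq_mul (leqnn _) main) _.
apply: leq_trans (_ : (2 ^ k * k`!) ^ (2 * m) *
    (m`! * t ^ m * (3 * X ^ m) * (((2 ^ k.+1 * X ^ k) ^ 2) ^ m)) <= _).
  rewrite leq_mul2l; apply/orP; right; apply: leq_mul; first by rewrite leq_mul.
  by rewrite leq_exp2r ?leq_exp2r // /m; lia.
have -> : (X ^ ((2 * k + 1) * m) = X ^ m * ((X ^ k) ^ 2) ^ m).
  by rewrite -!expnM -expnD; congr (_ ^ _); lia.
by rewrite eq_leq // [(2 * m)]mulnC [in RHS]mulnC !expnM !expnMn; ring.
Qed.

(** * Dilation operators on a finite field *)

Local Open Scope ring_scope.

Section Dot.
Variables (R : realFieldType) (I : finType).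
Implicit Types f g : I -> R.

Definition dot f g := \sum_x f x * g x.

Lemma dotC f g : dot f g = dot g f.
Proof. by apply: eq_bigr => x _; rewrite mulrC. Qed.

Lemma eq_dotr f g1 g2 : g1 =1 g2 -> dot f g1 = dot f g2.
Proof. by move=> eqg; apply: eq_bigr => x _; rewrite eqg. Qed.

Lemma dot_ge0 f : 0 <= dot f f.
Proof. by apply: sumr_ge0 => x _; rewrite -expr2 sqr_ge0. Qed.

Lemma dot_CauchySchwarz f g : dot f g ^+ 2 <= dot f f * dot g g.
Proof.
have : 0 <= \sum_x \sum_y (f x * g y - f y * g x) ^+ 2.
  by apply: sumr_ge0 => x _; apply: sumr_ge0 => y _; exact: sqr_ge0.
have -> : \sum_x \sum_y (f x * g y - f y * g x) ^+ 2 =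
    \sum_x \sum_y (f x * f x) * (g y * g y) +
    \sum_x \sum_y (g x * g x) * (f y * f y) -
    \sum_x \sum_y (f x * g x) * (f y * g y) *+ 2.
  rewrite -big_split -sumrB /=; apply: eq_bigr => x _.
  by rewrite -big_split -sumrB /=; apply: eq_bigr => y _; ring.
rewrite -!big_distrlr /=.
have -> : \sum_x \sum_y (f x * g x) * (f y * g y) *+ 2 = (dot f g ^+ 2) *+ 2.
  rewrite expr2 [dot f g * _]big_distrlr /= -sumrMnl; apply: eq_bigr => x _.
  by rewrite sumrMnl.
rewrite -/(dot f f) -/(dot g g) [dot g g * _]mulrC; lra.
Qed.

End Dot.

Section Dilations.
Variables (R : realFieldType) (F : finFieldType).
Variable s : seq nat.
Hypothesis s_neq0 : forall d, d \in s -> d%:R != 0 :> F.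
Implicit Types f g : F -> R.

Definition dilate f x := \sum_(d <- s) f (x / d%:R).
Definition codilate f x := \sum_(d <- s) f (x * d%:R).

Lemma dot_dilate f g : dot (dilate f) g = dot f (codilate g).
Proof.
rewrite /dot /dilate /codilate.
under eq_bigr do rewrite big_distrl.
under [RHS]eq_bigr do rewrite big_distrr.
rewrite exchange_big [RHS]exchange_big /= big_seq [RHS]big_seq.
apply: eq_bigr => d /s_neq0 d0.
rewrite (reindex_inj (mulIf d0)) /=.
by apply: eq_bigr => x _; rewrite mulfK.
Qed.

Lemma dilate_codilate f : dilate (codilate f) =1 codilate (dilate f).
Proof.
move=> x; rewrite /dilate /codilate exchange_big /=.
by apply: eq_bigr => d _; apply: eq_bigr => d' _; rewrite mulrAC.
Qed.

(** Dilations commute, so the operator is normal: it and its adjoint give vectors of equal norm. *)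
Lemma dot_codilate f : dot (codilate f) (codilate f) = dot (dilate f) (dilate f).
Proof.
rewrite -[LHS]dot_dilate dotC (eq_dotr _ (dilate_codilate f)).
by rewrite -[LHS]dot_dilate.
Qed.

(** With [T] the dilation operator and [T'] its adjoint, [|Tf|^2 = <f, T'Tf> <= |f| |T'Tf|], and
    normality gives [|T'Tf| = |TTf|]. *)
Lemma dilate_logconvex f :
  dot (dilate f) (dilate f) ^+ 2 <= dot f f * dot (dilate (dilate f)) (dilate (dilate f)).
Proof. by rewrite {1}dot_dilate -dot_codilate dot_CauchySchwarz. Qed.

(* By log-convexity, the ratio of consecutive norms of iterates is nondecreasing. *)
Lemma dilate_iter_ge (c : R) f m : 0 < c -> 0 < dot f f ->
    c * dot f f <= dot (dilate f) (dilate f) ->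
  c ^+ m * dot f f <= dot (iter m dilate f) (iter m dilate f).
Proof.
move=> c0 f0 cf.
suff : 0 < dot (iter m dilate f) (iter m dilate f) /\
    [/\ c ^+ m * dot f f <= dot (iter m dilate f) (iter m dilate f) &
     c * dot (iter m dilate f) (iter m dilate f)
       <= dot (iter m.+1 dilate f) (iter m.+1 dilate f)] by case=> ? [].
elim: m => [|m [h0 [h1 h2]]]; first by rewrite expr0 mul1r.
have h3 : 0 < dot (iter m.+1 dilate f) (iter m.+1 dilate f).
  by apply: lt_le_trans h2; rewrite mulr_gt0.
split=> //; split.
  by rewrite exprS -mulrA (le_trans _ h2) // ler_pM2l.
have /= := dilate_logconvex (iter m dilate f).
move: h0 h2 h3 => /=.
set u := dot (iter _ _ _) _; set v := dot _ _; set w := dot _ _ => u0 uv v0 vw.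
rewrite -(ler_pM2l u0); apply: le_trans vw.
by rewrite mulrA [u * c]mulrC expr2 ler_pM2r.
Qed.

Lemma iter_dilate f m x : iter m dilate f x = \sum_(n <- words s m) f (x / n%:R).
Proof.
elim: m x => [|m IHm] x /=; first by rewrite big_seq1 divr1.
rewrite big_allpairs_dep /dilate; apply: eq_bigr => d _.
by rewrite IHm; apply: eq_bigr => n _; rewrite natrM invfM mulrA mulrAC -!mulrA.
Qed.

Lemma sum_dot_words f g m :
  \sum_(n <- words s m) dot g (fun x => f (x / n%:R)) = dot g (iter m dilate f).
Proof.
rewrite exchange_big /=; apply: eq_bigr => x _.
by rewrite iter_dilate big_distrr.
Qed.

End Dilations.

(** * Correlations with the dilates of a function *)

Section Correlation.
Variables (R : realFieldType) (F : finFieldType) (f g : F -> R).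
Hypothesis f0 : f 0 = 0.

(** For [x != 0] the map [z -> x / z] permutes the whole field, since the inverse of 0 is 0; for
    [x = 0] every term contains [f 0 = 0]. *)
Lemma sum_dot_dilation : \sum_x f x = 0 -> \sum_z dot g (fun x => f (x / z)) = 0.
Proof.
move=> sumf; rewrite exchange_big big1 //= => x _; rewrite -big_distrr /=.
have [->|x0] := eqVneq x 0.
  by rewrite big1 ?mulr0 // => z _; rewrite mul0r.
rewrite (reindex_inj invr_inj) /= (reindex_inj (mulfI (invr_neq0 x0))) /=.
rewrite (eq_bigr f) ?sumf ?mulr0 // => z _.
by rewrite invrK mulrA divff // mul1r.
Qed.

Lemma dot_dilation_le z : dot g (fun x => f (x / z)) ^+ 2 <= dot g g * dot f f.
Proof.
apply: le_trans (dot_CauchySchwarz _ _) _; rewrite ler_wpM2l ?dot_ge0 //.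
have [->|z0] := eqVneq z 0.
  by rewrite {1}/dot big1 ?dot_ge0 // => x _; rewrite invr0 mulr0 f0 mulr0.
by rewrite {1}/dot (reindex_inj (mulIf z0)) /= le_eqVlt; apply/orP; left;
  apply/eqP/eq_bigr => x _; rewrite mulfK.
Qed.

End Correlation.

(** * The centred indicator function when a class is missed *)

Section MissedClass.
Variables (R : realFieldType) (F : finFieldType) (s : seq nat).
Hypothesis s_neq0 : forall d, d \in s -> d%:R != 0 :> F.
Variables (A B : {set F}) (a : F).
Hypotheses (A0 : 0 \notin A) (B0 : 0 \notin B) (a0 : a != 0).
Hypothesis missed : forall c b d, c \in A -> b \in B -> d \in s -> c * b * d%:R != a.

Let beta : R := #|B|%:R / (#|F|.-1)%:R.

(** The mean [beta] is subtracted on nonzero elements only, so that the function has sum 0 and still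
    vanishes at 0. *)
Definition centered (x : F) : R := (x \in B)%:R - (x != 0)%:R * beta.

Lemma card_neq0 : \sum_(x : F) ((x != 0)%:R : R) = (#|F|.-1)%:R.
Proof.
rewrite -natr_sum -(cardC1 (0 : F)) -sum1_card; congr _%:R; rewrite [RHS]big_mkcond.
by apply: eq_bigr => x _; rewrite inE; case: (x != 0).
Qed.

Lemma sum_indicator : \sum_(x : F) ((x \in B)%:R : R) = #|B|%:R.
Proof.
rewrite -natr_sum -sum1_card; congr _%:R; rewrite [RHS]big_mkcond.
by apply: eq_bigr => x _; case: (x \in B).
Qed.

Let pred_card_gt0 : 0 < (#|F|.-1)%:R :> R.
Proof. by rewrite ltr0n -subn1 subn_gt0 card_finNzRing_gt1. Qed.

Let beta_card : beta * (#|F|.-1)%:R = #|B|%:R.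
Proof. by rewrite divfK // gt_eqF. Qed.

Lemma centered0 : centered 0 = 0.
Proof. by rewrite /centered (negbTE B0) eqxx mul0r subr0. Qed.

Lemma sum_centered : \sum_x centered x = 0.
Proof.
by rewrite sumrB -big_distrl /= sum_indicator card_neq0 mulrC beta_card subrr.
Qed.

Lemma dot_centered_le : dot centered centered <= #|B|%:R.
Proof.
have -> : dot centered centered = #|B|%:R - beta * #|B|%:R.
  have -> : dot centered centered =
     \sum_x ((x \in B)%:R - beta * (x \in B)%:R - beta * centered x).
    apply: eq_bigr => x _; rewrite /centered.
    have : x \in B -> x != 0 by apply: contraTneq => ->.
    by case: (x \in B) => [/(_ isT) ->|_]; case: (x != 0) => /=; ring.
  by rewrite !sumrB -!big_distrr /= sum_centered sum_indicator mulr0 subr0.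
by rewrite gerBl mulr_ge0 // divr_ge0.
Qed.

(** At [x = a / c] with [c] in [A], no [x / d] lies in [B], since [c b d = a] is excluded, so every
    term of the dilation sum is [-beta]. There are [#|A|] such points. *)
Lemma dot_dilate_centered_ge :
  #|A|%:R * ((size s)%:R * beta) ^+ 2 <=
  dot (dilate s centered) (dilate s centered).
Proof.
pose A' := [set a / c | c in A].
have Aneq0 c : c \in A -> c != 0 by apply: contraTneq => ->.
have cA' : #|A'| = #|A|.
  apply: card_imset => c c' /(mulfI a0); exact: invr_inj.
have val x : x \in A' -> dilate s centered x = - ((size s)%:R * beta).
  case/imsetP => c cA ->; rewrite /dilate big_seq (eq_bigr (fun=> - beta)); last first.
    move=> d ds; have nz : a / c / d%:R != 0.
      by rewrite !(mulf_eq0, invr_eq0) !negb_or a0 Aneq0 ?s_neq0.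
    rewrite /centered nz.
    suff /negbTE -> : a / c / d%:R \notin B by rewrite mul1r sub0r.
    apply/negP => bB; have /eqP[] := missed cA bB ds.
    by rewrite mulrA divfK ?s_neq0 // mulrC divfK ?Aneq0.
  by rewrite -big_seq big_const_seq count_predT iter_addr_0 mulNrn mulr_natl.
rewrite /dot (bigID (mem A')) /= -[leLHS]addr0 lerD //; last first.
  by apply: sumr_ge0 => x _; rewrite -expr2 sqr_ge0.
rewrite (eq_bigr (fun=> ((size s)%:R * beta) ^+ 2)); last first.
  by move=> x /val ->; rewrite mulrNN expr2.
by rewrite sumr_const cA' mulr_natl.
Qed.

End MissedClass.

(** * The sieve over primes *)

Section Periodic.
Variable R : realFieldType.

Definition periodic p (h : nat -> R) := forall n, h (n + p)%N = h n.

Lemma periodicM p h k n : periodic p h -> h (n + k * p)%N = h n.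
Proof. by move=> hp; elim: k => [|k IHk]; rewrite ?addn0 // mulSn addnCA addnC hp. Qed.

Lemma sum_periodic p (h : nat -> R) k : periodic p h ->
  \sum_(n < k * p) h n = (\sum_(n < p) h n) *+ k.
Proof.
move=> hp; elim: k => [|k IHk]; first by rewrite big_ord0 mulr0n.
rewrite mulSn addnC big_split_ord /= IHk mulrSr; congr (_ + _).
by apply: eq_bigr => i _; rewrite addnC periodicM.
Qed.

Lemma periodic_modn p h n : periodic p h -> h (n %% p)%N = h n.
Proof. by move=> hp; rewrite {2}(divn_eq n p) addnC periodicM. Qed.

(** Full periods cancel; fewer than [q] terms remain, each at most 1. *)
Lemma sum_periodic_bound q (h : nat -> R) N : (0 < q)%N -> periodic q h ->
  \sum_(n < q) h n = 0 -> (forall n, `|h n| <= 1) -> \sum_(n < N) h n <= q%:R.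
Proof.
move=> q0 hq sum0 h1; rewrite (divn_eq N q) big_split_ord /=.
rewrite (sum_periodic _ hq) sum0 mul0rn add0r.
apply: le_trans (_ : \sum_(i < N %% q) 1 <= _).
  by apply: ler_sum => i _; apply: le_trans (ler_norm _) (h1 _).
by rewrite sumr_const card_ord ler_nat ltnW // ltn_mod.
Qed.

(** As [p] is invertible modulo [q], the map [u -> c + u p] permutes the residues modulo [q]. *)
Lemma sum_coprime_dilation p q (h : nat -> R) c : (0 < q)%N -> coprime p q ->
  periodic q h -> \sum_(u < q) h (c + u * p)%N = \sum_(u < q) h u.
Proof.
move=> q0 pq hq.
pose f (u : 'I_q) := Ordinal (ltn_pmod (c + u * p) q0).
have finj : injective f.
  move=> u v /(congr1 val) /= /eqP; rewrite eqn_modDl.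
  wlog uv : u v / (u <= v)%N.
    by move=> W; case/orP: (leq_total u v) => [/W//|/W{}W]; rewrite eq_sym => /W.
  rewrite eq_sym eqn_mod_dvd ?leq_mul2r ?uv ?orbT // -mulnBl Gauss_dvdl 1?coprime_sym //.
  move=> /dvdnP[k]; have := ltn_ord v; have := ltn_ord u => ? ? e; apply/val_inj => /=.
  by case: k e => [|k]; nia.
rewrite [RHS](reindex_inj finj) /=.
by apply: eq_bigr => u _; rewrite periodic_modn.
Qed.

(** Write [n = v + u p]: for fixed [v] the first factor is constant in [u], and the second runs over
    all residues modulo [q]. *)
Lemma sum_mul_periodic p q (h h' : nat -> R) : (0 < q)%N -> coprime p q ->
  periodic p h -> periodic q h' -> \sum_(u < q) h' u = 0 ->
  \sum_(n < q * p) h n * h' n = 0.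
Proof.
move=> q0 pq hp hq h'0.
have -> : \sum_(n < q * p) h n * h' n = 
   \sum_(u < q) \sum_(v < p) h (v + u * p)%N * h' (v + u * p)%N.
  elim: (q) => [|k IHk]; first by rewrite !big_ord0.
  rewrite mulSn addnC big_split_ord /= IHk big_ord_recr /=; congr (_ + _).
  by apply: eq_bigr => i _; rewrite addnC.
rewrite exchange_big big1 //= => v _.
under eq_bigr do rewrite periodicM //.
by rewrite -big_distrr /= sum_coprime_dilation // h'0 mulr0.
Qed.

(* The dual form of the large sieve: the off-diagonal terms are incomplete sums
   over a period [p * q] of products with zero mean, so each is at most [p * q]. *)
Lemma large_sieve_dual (E : seq nat) (Y N : nat) (h : nat -> nat -> R) :
    uniq E -> (forall p, p \in E -> prime p /\ (p <= Y)%N) ->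
    (forall p n, p \in E -> `|h p n| <= 1) ->
    (forall p, p \in E -> periodic p (h p)) ->
    (forall p, p \in E -> \sum_(n < p) h p n = 0) ->
  \sum_(n < N) (\sum_(p <- E) h p n) ^+ 2 <=
    ((size E) * N + (size E) ^ 2 * Y ^ 2)%:R.
Proof.
move=> uE pE hE1 hEp hE0.
under eq_bigr do rewrite expr2 big_distrlr /=.
rewrite exchange_big /=.
under eq_bigr do rewrite exchange_big /=.
apply: le_trans (_ : \sum_(p <- E) \sum_(q <- E) ((p == q)%:R * N%:R + (Y ^ 2)%:R) <= _).
  rewrite big_seq [leRHS]big_seq; apply: ler_sum => p Ep.
  rewrite big_seq [leRHS]big_seq; apply: ler_sum => q Eq.
  have [pr_p pY] := pE p Ep; have [pr_q qY] := pE q Eq.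
  have hh1 n : `|h p n * h q n| <= 1.
    by rewrite normrM mulr_ile1 ?normr_ge0 ?hE1.
  have [eqpq|npq] := eqVneq p q.
    rewrite mul1r ler_wpDr //; apply: le_trans (_ : \sum_(n < N) 1 <= _).
      by apply: ler_sum => n _; apply: le_trans (ler_norm _) (hh1 _).
    by rewrite sumr_const card_ord.
  have pq : coprime p q.
    by rewrite prime_coprime // dvdn_prime2.
  rewrite mul0r add0r; apply: le_trans (_ : (q * p)%:R <= _).
    apply: (@sum_periodic_bound _ (fun n => h p n * h q n)) => //.
    - by rewrite muln_gt0 !prime_gt0.
    - move=> n; congr (_ * _); first exact: (periodicM _ _ (hEp p Ep)).
      by rewrite mulnC; exact: (periodicM _ _ (hEp q Eq)).
    - by apply: sum_mul_periodic; rewrite ?prime_gt0 //; auto.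
  by rewrite ler_nat -mulnn leq_mul.
rewrite le_eqVlt; apply/orP; left; apply/eqP.
rewrite natrD.
have -> : \sum_(p <- E) \sum_(q <- E) ((p == q)%:R * N%:R + (Y ^ 2)%:R) =
  \sum_(p <- E) (N%:R + (Y ^ 2)%:R *+ size E) :> R.
  rewrite big_seq [RHS]big_seq; apply: eq_bigr => p Ep.
  rewrite big_split /= -big_distrl /=; congr (_ + _); last first.
    by rewrite big_const_seq count_predT iter_addr_0.
  rewrite (bigD1_seq p) //= eqxx big1 ?addr0 ?mul1r // => q.
  by rewrite eq_sym => /negbTE ->.
rewrite big_const_seq count_predT iter_addr_0 -[LHS]mulr_natl.
by rewrite -[_ *+ size E]mulr_natl !natrM; ring.
Qed.

End Periodic.

(** * From residue fields to integer arguments *)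

Lemma sum_Fp (R : nmodType) p (H : 'F_p -> R) : prime p ->
  \sum_(n < p) H (n : nat)%:R = \sum_z H z.
Proof.
move=> pr_p; have -> : \sum_(z : 'F_p) H z = \sum_(z : 'F_p) H (z : nat)%:R.
  by apply: eq_bigr => z _; rewrite natr_Zp.
rewrite -(big_mkord xpredT (fun n => H n%:R)).
have -> : index_iota 0 p = index_iota 0 (Zp_trunc (pdiv p)).+2 by rewrite Fp_cast.
by rewrite big_mkord.
Qed.

Lemma Fp_nat_eq0 p n : prime p -> ((n%:R : 'F_p) == 0) = (p %| n)%N.
Proof. by move=> pr_p; rewrite -val_eqE /= val_Fp_nat // /dvdn. Qed.

Lemma Fp_nat_eq p a b : prime p -> (a%:R == b%:R :> 'F_p) = (a == b %[mod p])%N.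
Proof. by move=> pr_p; rewrite -val_eqE /= !val_Fp_nat. Qed.

Lemma card_Fp_image p (A : seq nat) : prime p -> uniq A ->
    (forall c, c \in A -> (0 < c < p)%N) ->
  #|[set x in [seq (c%:R : 'F_p) | c <- A]]| = size A.
Proof.
move=> pr_p uA Ap; rewrite cardsE (card_uniqP _) ?size_map //.
rewrite map_inj_in_uniq // => c d /Ap /andP[_ cp] /Ap /andP[_ dp] /eqP.
by rewrite Fp_nat_eq // !modn_small // => /eqP.
Qed.

(** With [T] the dilation operator, [h n] is the inner product of [T^m f] with the dilate of [f] by
    [n], divided by [|T^m f| |f|]; over the words it sums to [|T^m f| / |f|]. The ratio in the last
    bound comes from [|Tf|^2 >= |A| (|s| beta)^2] and [|f|^2 <= |B|]. *)
Lemma exists_correlation (R : rcfType) p (A B s : seq nat) (a m : nat) :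
    prime p -> uniq A -> uniq B -> (0 < size A)%N -> (0 < size B)%N -> (0 < size s)%N ->
    (forall c, c \in A -> (0 < c < p)%N) -> (forall c, c \in B -> (0 < c < p)%N) ->
    (forall c, c \in s -> (0 < c < p)%N) -> coprime a p ->
    (forall c b d, c \in A -> b \in B -> d \in s -> c * b * d != a %[mod p])%N ->
  exists h : nat -> R, [/\ forall n, `|h n| <= 1, periodic p h,
    \sum_(n < p) h n = 0, 0 <= \sum_(n <- words s m) h n &
    ((size A * size B * size s ^ 2)%:R / (p ^ 2)%:R) ^+ m
      <= (\sum_(n <- words s m) h n) ^+ 2].
Proof.
move=> pr_p uA uB A0 B0 s0 Ap Bp sp ap miss.
pose A' := [set x in [seq (c%:R : 'F_p) | c <- A]].
pose B' := [set x in [seq (c%:R : 'F_p) | c <- B]].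
have nz c : (0 < c < p)%N -> c%:R != 0 :> 'F_p.
  by move=> /andP[c0 cp]; rewrite Fp_nat_eq0 // gtnNdvd.
have cA : #|A'| = size A by apply: card_Fp_image.
have cB : #|B'| = size B by apply: card_Fp_image.
have nA : 0 \notin A'.
  by rewrite inE; apply/mapP => -[c /Ap/nz + e]; rewrite -e eqxx.
have nB : 0 \notin B'.
  by rewrite inE; apply/mapP => -[c /Bp/nz + e]; rewrite -e eqxx.
have ns d : d \in s -> d%:R != 0 :> 'F_p by move=> /sp /nz.
have na : a%:R != 0 :> 'F_p.
  by rewrite Fp_nat_eq0 // -prime_coprime // coprime_sym.
have miss' c b d : c \in A' -> b \in B' -> d \in s -> c * b * d%:R != a%:R.
  rewrite !inE => /mapP[c' c'A ->] /mapP[b' b'B ->] ds.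
  by rewrite -!natrM Fp_nat_eq // miss.
pose f : 'F_p -> R := centered R B'.
have f0 : f 0 = 0 by apply: centered0.
have sumf : \sum_x f x = 0 by apply: sum_centered.
have uf : dot f f <= #|B'|%:R by apply: dot_centered_le.
have := dot_dilate_centered_ge R ns nA na miss'.
rewrite -/f cA cB (card_Fp pr_p) => lf.
rewrite cB in uf.
set beta := _ / (p.-1)%:R in lf.
set gam := (_ / (p ^ 2)%:R).
have p1 : (0 < p.-1)%N by rewrite -subn1 subn_gt0 prime_gt1.
have p0 : 0 < (p.-1)%:R :> R by rewrite ltr0n.
have gam0 : 0 < gam.
  rewrite divr_gt0 // ltr0n; last by rewrite expn_gt0 prime_gt0.
  by rewrite !muln_gt0 A0 B0 s0.
have gamf : gam * (size B)%:R <= dot (dilate s f) (dilate s f).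
  apply: le_trans lf.
  have -> : (size A)%:R * ((size s)%:R * beta) ^+ 2 =
    (size A * size B * size s ^ 2)%:R / (p.-1 ^ 2)%:R * (size B)%:R.
    by rewrite /beta !natrM; field; rewrite gt_eqF.
  rewrite ler_wpM2r // ler_wpM2l // lef_pV2 ?posrE ?ltr0n ?expn_gt0 ?p1 ?prime_gt0 //.
  by rewrite ler_nat leq_exp2r // leq_pred.
have lf' : gam * dot f f <= dot (dilate s f) (dilate s f).
  by apply: le_trans gamf; rewrite ler_pM2l.
(* If [f] were zero, so would be [dilate s f], against [gamf]. This makes the normalisation by [D]
   legitimate. *)
have f_gt0 : 0 < dot f f.
  rewrite lt_neqAle dot_ge0 andbT; apply/eqP => ff0.
  have fx0 x : f x = 0.
    apply/eqP; rewrite -sqrf_eq0 eq_le sqr_ge0 andbT [leRHS]ff0 expr2.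
    rewrite /dot (bigD1 x) //= lerDl sumr_ge0 // => y _.
    by rewrite -expr2 sqr_ge0.
  have := lt_le_trans (mulr_gt0 gam0 _) gamf.
  rewrite ltr0n {1}/dot big1 ?ltxx => [/(_ B0)//|x _].
  by rewrite /dilate big1 ?mul0r // => d _; rewrite fx0.
pose g := iter m (dilate s) f.
have lg : gam ^+ m * dot f f <= dot g g by apply: dilate_iter_ge.
have g_gt0 : 0 < dot g g by apply: lt_le_trans lg; rewrite mulr_gt0 ?exprn_gt0.
pose D := Num.sqrt (dot g g * dot f f).
have D0 : 0 < D by rewrite sqrtr_gt0 mulr_gt0.
have D2 : D ^+ 2 = dot g g * dot f f by rewrite sqr_sqrtr // ltW // mulr_gt0.
exists (fun n => dot g (fun x => f (x / n%:R)) / D).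
have -> : \sum_(n <- words s m) dot g (fun x => f (x / n%:R)) / D = dot g g / D.
  by rewrite -big_distrl /= sum_dot_words.
split.
- move=> n; rewrite normrM normfV (gtr0_norm D0) ler_pdivrMr // mul1r.
  by rewrite -sqrtr_sqr ler_wsqrtr // dot_dilation_le.
- by move=> n; rewrite natrD [p%:R](_ : _ = 0) ?addr0 //; apply/eqP; rewrite Fp_nat_eq0.
- rewrite -big_distrl /= (sum_Fp (fun z => dot g (fun x => f (x / z))) pr_p).
  by rewrite sum_dot_dilation // mul0r.
- by rewrite divr_ge0 ?ltW.
- by rewrite [leRHS]expr_div_n D2 expr2 -mulf_div divff ?gt_eqF // mul1r ler_pdivlMr.
Qed.

(* Cauchy-Schwarz on the sum of [H] over the words, grouped by their products. *)
Lemma sum_words_sqr_le (R : realFieldType) (s : seq nat) X m (H : nat -> R) :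
    uniq s -> (forall d, d \in s -> prime d /\ (d <= X)%N) ->
  (\sum_(n <- words s m) H n) ^+ 2 <=
    (m`! * size s ^ m)%:R * \sum_(n < (X ^ m).+1) H n ^+ 2.
Proof.
move=> us sX.
have prs d : d \in s -> prime d by move=> /sX[].
have wX n : n \in words s m -> (n < (X ^ m).+1)%N.
  by apply: words_le => d /sX[].
pose c (n : 'I_(X ^ m).+1) : R := (count_mem (n : nat) (words s m))%:R.
have group (G : nat -> R) :
   \sum_(n <- words s m) G n = \sum_(n < (X ^ m).+1) c n * G n.
  rewrite big_seq.
  under eq_bigr => n nw.
    rewrite (_ : G n = \sum_(i < (X ^ m).+1) (i == n :> nat)%:R * G i); last first.
      rewrite (bigD1 (Ordinal (wX _ nw))) //= eqxx mul1r big1 ?addr0 // => i.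
      by rewrite -val_eqE /= => /negbTE ->; rewrite mul0r.
    over.
  rewrite -big_seq exchange_big /=; apply: eq_bigr => i _.
  rewrite -big_distrl /= /c -sum1_count natr_sum; congr (_ * _).
  rewrite [RHS]big_mkcond; apply: eq_bigr => n _ /=.
  by rewrite eq_sym; case: (n == _).
rewrite group; apply: le_trans (dot_CauchySchwarz c (fun i => H i)) _.
have -> : dot (fun i : 'I_(X ^ m).+1 => H i) (fun i => H i) = \sum_(n < (X ^ m).+1) H n ^+ 2.
  by apply: eq_bigr => i _; rewrite expr2.
rewrite ler_wpM2r ?sumr_ge0 // => [i _|]; first exact: sqr_ge0.
(* In the sum of [c n ^ 2], one factor is at most [m!] and the other sums to the number of words. *)
have -> : (m`! * size s ^ m)%:R = \sum_(n < (X ^ m).+1) c n * m`!%:R.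
  by rewrite -(group (fun=> m`!%:R)) big_const_seq count_predT iter_addr_0
    size_words natrM mulr_natr.
apply: ler_sum => n _; rewrite ler_wpM2l // ler_nat; exact: count_words.
Qed.

(** The sum of the correlations over [E] and the words is at least [size E] times the square root of
    [gam^m]. Its square is bounded by Cauchy-Schwarz over the words and the dual large sieve, and
    one factor [size E] cancels. *)
Lemma card_missed_le (R : rcfType) (E A B s : seq nat) (X Y m : nat) :
    uniq E -> uniq A -> uniq B -> uniq s ->
    (0 < size A)%N -> (0 < size B)%N -> (0 < size s)%N ->
    (forall d, d \in s -> prime d /\ (d <= X)%N) ->
    (forall p, p \in E -> [/\ prime p, (p <= Y)%N,
      forall c, c \in A ++ B ++ s -> (0 < c < p)%N &
      exists2 a, coprime a p &
       forall c b d, c \in A -> b \in B -> d \in s -> c * b * d != a %[mod p]]%N) ->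
  (size E)%:R * ((size A * size B * size s ^ 2)%:R / (Y ^ 2)%:R) ^+ m <=
    ((m`! * size s ^ m) * ((X ^ m).+1 + size E * Y ^ 2))%:R :> R.
Proof.
move=> uE uA uB us A0 B0 s0 sX Ep.
have [->|E0] := posnP (size E); first by rewrite mul0r.
have /choice [h hP] : forall p, exists h : nat -> R, p \in E ->
   [/\ forall n, `|h n| <= 1, periodic p h,
    \sum_(n < p) h n = 0, 0 <= \sum_(n <- words s m) h n &
    ((size A * size B * size s ^ 2)%:R / (p ^ 2)%:R) ^+ m
      <= (\sum_(n <- words s m) h n) ^+ 2].
  move=> p; have [pE|] := boolP (p \in E); last by exists (fun=> 0).
  have [pr_p _ cp [a ap miss]] := Ep p pE.
  have [|||h hP] := @exists_correlation R p A B s a m pr_p uA uB A0 B0 s0 _ _ _ ap miss.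
  - by move=> c cA; apply: cp; rewrite !mem_cat cA.
  - by move=> c cA; apply: cp; rewrite !mem_cat cA orbT.
  - by move=> c cA; apply: cp; rewrite !mem_cat cA !orbT.
  by exists h.
set gam := _ / (Y ^ 2)%:R.
have gam0 : 0 <= gam by rewrite divr_ge0.
pose S := \sum_(p <- E) \sum_(n <- words s m) h p n.
have lS : (size E)%:R * Num.sqrt (gam ^+ m) <= S.
  rewrite /S mulr_natl -iter_addr_0 -count_predT -big_const_seq.
  rewrite big_seq [leRHS]big_seq; apply: ler_sum => p pE.
  have [_ _ _ h0 hm] := hP p pE; have [pr_p pY _ _] := Ep p pE.
  have Y0 : (0 < Y)%N by apply: leq_trans pY; exact: prime_gt0.
  rewrite -[leRHS]ger0_norm // -sqrtr_sqr ler_wsqrtr //.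
  apply: le_trans hm; apply: lerXn2r; rewrite ?nnegrE ?divr_ge0 //.
  rewrite ler_wpM2l // lef_pV2 ?posrE ?ltr0n ?expn_gt0 ?(prime_gt0 pr_p) ?Y0 //.
  by rewrite ler_nat leq_exp2r.
have sieve : \sum_(n < (X ^ m).+1) (\sum_(p <- E) h p n) ^+ 2 <=
    ((size E) * (X ^ m).+1 + (size E) ^ 2 * Y ^ 2)%:R.
  apply: large_sieve_dual => //.
  - by move=> p /Ep[].
  - by move=> p n /hP[].
  - by move=> p /hP[].
  - by move=> p /hP[].
have := sum_words_sqr_le m (fun n => \sum_(p <- E) h p n) us sX.
rewrite exchange_big -/S => /le_trans /(_ (ler_wpM2l (ler0n _ _) sieve)).
have lS2 : (size E)%:R ^+ 2 * gam ^+ m <= S ^+ 2.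
  rewrite -[gam ^+ m]sqr_sqrtr ?exprn_ge0 // -exprMn.
  have l0 : 0 <= (size E)%:R * Num.sqrt (gam ^+ m) by rewrite mulr_ge0 ?sqrtr_ge0.
  by rewrite lerXn2r ?nnegrE // (le_trans l0).
move=> /(le_trans lS2).
rewrite -natrM expr2 -mulrA => le1; rewrite -(ler_pM2l (_ : 0 < (size E)%:R)) ?ltr0n //.
apply: le_trans le1 _; rewrite -natrM ler_nat.
by rewrite [leqRHS]mulnCA leq_mul2l mulnDr mulnA mulnn leqnn orbT.
Qed.

(** * Exceptional primes *)

Lemma Mstar_le (R : realType) (alpha : R) q M :
  reaches_reduced_classes alpha q M -> (Mstar alpha q <= M%:R%:E)%E.
Proof.
move=> hM; rewrite /Mstar; case: pselect => [exM|[]]; last by exists M; apply/asboolP.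
by rewrite lee_fin ler_nat; case: ex_minnP => n _; apply; apply/asboolP.
Qed.

Section SmoothProducts.
Variables (X k : nat).
Implicit Types (U V : {set 'I_X.+1}).

Definition subset_prods U : seq nat :=
  [seq set_prod V | V in [set V : {set 'I_X.+1} | V \subset U & #|V| == k]].

Lemma mem_subset_prods U n : n \in subset_prods U ->
  exists V, [/\ V \subset U, #|V| = k & n = set_prod V].
Proof. by case/mapP => V; rewrite mem_enum inE => /andP[VU /eqP cV] ->; exists V. Qed.

Lemma prime_set_sub U V : prime_set U -> V \subset U -> prime_set V.
Proof. by move=> pU /fintype.subsetP VU i /VU /pU. Qed.

Lemma subset_prods_uniq U : prime_set U -> uniq (subset_prods U).
Proof.
move=> pU; rewrite map_inj_in_uniq ?enum_uniq // => V W.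
rewrite !mem_enum !inE => /andP[VU _] /andP[WU _].
by apply: set_prod_inj; apply: prime_set_sub pU _.
Qed.

Lemma size_subset_prods U : size (subset_prods U) = 'C(#|U|, k).
Proof. by rewrite size_map -cardE cards_draws. Qed.

(** The product is at most [X^k <= p]. It cannot equal the prime [p], which would then be one of the
    factors and so at most [X < X^k]. *)
Lemma subset_prods_lt U p n : (1 < k)%N -> prime_set U -> prime p ->
  (X ^ k <= p)%N -> n \in subset_prods U -> (0 < n < p)%N.
Proof.
move=> k1 pU pr_p Xp /mem_subset_prods[V [VU cV ->]].
have pV := prime_set_sub pU VU.
rewrite set_prod_gt0 //= ltn_neqAle; apply/andP; split; last first.
  by apply: leq_trans Xp; rewrite -cV set_prod_le.
apply/eqP => eVp; have [i iV pi] : exists2 i, i \in V & p = i.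
  by apply: prime_dvd_set_prod => //; rewrite eVp.
have iX : (i <= X)%N by rewrite -ltnS ltn_ord.
have i1 := prime_gt1 (pV i iV).
have : (X ^ 1 < X ^ k)%N by rewrite ltn_exp2l // (leq_trans i1).
by rewrite expn1 ltnNge (leq_trans Xp) // pi.
Qed.

End SmoothProducts.

Section Exceptional.
Variables (R : realType) (alpha delta Q : R) (X k : nat).
Hypotheses (k_gt1 : (1 < k)%N) (X_gt1 : (1 < X)%N) (XQ : (X ^ k)%:R <= Q).
Hypotheses (alpha_ge0 : 0 <= alpha) (delta_ge0 : 0 <= delta).
Hypotheses (Xalpha : X%:R <= Q `^ alpha) (Xdelta : X%:R <= Q `^ delta).

Let Q1 : 1 <= Q.
Proof. by apply: le_trans XQ; rewrite ler1n expn_gt0 ltnW. Qed.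

(** If no class were missed, each would contain some [c b d], square-free by disjointness, with
    prime factors at most [X <= p^alpha] and of size at most [X^(2k) X <= p^(2 + delta)]; then [p]
    would not be exceptional. *)
Lemma missed_of_exceptional (U V W : {set 'I_X.+1}) p : prime p -> Q <= p%:R ->
    prime_set U -> prime_set V -> prime_set W ->
    [disjoint U & V] -> [disjoint U & W] -> [disjoint V & W] ->
    ~~ (Mstar alpha p <= (p%:R `^ (2 + delta))%:E)%E ->
  exists2 a, coprime a p & forall c b d, c \in subset_prods k U ->
    b \in subset_prods k V -> d \in map val (enum W) ->
    (c * b * d != a %[mod p])%N.
Proof.
move=> pr_p Qp pU pV pW dUV dUW dVW /negP exc; apply: contrapT => nomiss; apply: exc.
have p1 : 1 <= p%:R :> R by rewrite (le_trans Q1).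
pose M := Num.truncn (p%:R `^ (2 + delta) : R).
apply: (@le_trans _ _ (M%:R)%:E); last first.
  by rewrite lee_fin truncn_le powR_ge0.
apply: Mstar_le => a ap.
have [c [b [d [cU bV dW /eqP eqa]]]] : exists c b d, [/\ c \in subset_prods k U,
    b \in subset_prods k V, d \in map val (enum W) & (c * b * d == a %[mod p])%N].
  apply: contrapT => none; apply: nomiss; exists a => // c b d cU bV dW.
  by apply/negP => eqa; apply: none; exists c, b, d.
exists (c * b * d)%N.
have [U' [sU' cU' eqc]] := mem_subset_prods cU.
have [V' [sV' cV' eqb]] := mem_subset_prods bV.
have /mapP[i + eqd] := dW; rewrite mem_enum => iW.
have pU' := prime_set_sub pU sU'; have pV' := prime_set_sub pV sV'.
have dUV' : [disjoint U' & V'].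
  exact: disjointWl sU' (disjointWr sV' dUV).
have iUV : [disjoint U' :|: V' & [set i]].
  rewrite disjoint_sym disjoints1 !inE negb_or.
  by rewrite (contraFN (fintype.subsetP sU' i) (disjointFl dUW iW))
             (contraFN (fintype.subsetP sV' i) (disjointFl dVW iW)).
have eqZ : (c * b * d = set_prod (U' :|: V' :|: [set i]))%N.
  by rewrite eqc eqb eqd !set_prodU // /set_prod big_set1.
rewrite eqZ in eqa *.
set Z := U' :|: V' :|: [set i].
have pZ : prime_set Z.
  by move=> j; rewrite !inE => /orP[/orP[/pU'|/pV']|/eqP ->] //; exact: pW.
split.
- rewrite set_prod_gt0 //= truncn_ge_nat ?powR_ge0 //.
  rewrite !set_prodU // [set_prod [set i]]big_set1.
  apply: (@le_trans _ _ ((X ^ k * X ^ k * X)%:R : R)).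
    have lU : (set_prod U' <= X ^ k)%N by rewrite -cU' set_prod_le.
    have lV : (set_prod V' <= X ^ k)%N by rewrite -cV' set_prod_le.
    by rewrite ler_nat !leq_mul // -ltnS.
  rewrite powRD; last by apply/implyP => _; rewrite gt_eqF // (lt_le_trans ltr01).
  rewrite !natrM ler_pM // ?mulr_ge0 //.
    by rewrite powR_mulrn // expr2 ler_pM // (le_trans XQ).
  by apply: le_trans Xdelta _; rewrite ge0_ler_powR // ?nnegrE // (le_trans ler01).
- exact: eqa.
- move=> l pr_l /(prime_dvd_set_prod pr_l pZ)[j _ ->].
  apply: (@le_trans _ _ X%:R); first by rewrite ler_nat -ltnS.
  apply: le_trans Xalpha _.
  by rewrite ge0_ler_powR // ?nnegrE // (le_trans ler01).
- by move=> l pr_l; exact: set_prod_squarefree.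
Qed.

(** This is [card_missed_le] cleared of denominators: two of three disjoint prime sets supply the
    [k]-fold products, the third the letters of the words. *)
Lemma nb_exceptional_le m (t := (#|[set i : 'I_X.+1 | prime i]| %/ 3)%N)
    (Y := Num.truncn (2 * Q)) (e := nb_exceptional alpha delta Q) :
    (0 < t)%N -> (k <= t)%N ->
  (e * ('C(t, k) * 'C(t, k) * t ^ 2) ^ m <=
     m`! * t ^ m * ((X ^ m).+1 + e * Y ^ 2) * (Y ^ 2) ^ m)%N.
Proof.
move=> t0 kt.
have [U [Usub Udis]] : exists U : 'I_3 -> {set 'I_X.+1},
    (forall i, U i \subset [set i | prime (i : 'I_X.+1)] /\ #|U i| = t) /\
    (forall i j, i != j -> [disjoint U i & U j]).
  by apply: exists_three_subsets; rewrite mulnC leq_divM.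
have pU i : prime_set (U i).
  by move=> j; have [/fintype.subsetP sU _] := Usub i; move=> /sU; rewrite inE.
have cU i : #|U i| = t by have [] := Usub i.
pose i0 : 'I_3 := ord0; pose i1 : 'I_3 := lift ord0 ord0; pose i2 : 'I_3 := ord_max.
pose A := subset_prods k (U i0); pose B := subset_prods k (U i1).
pose s : seq nat := map val (enum (U i2)).
have szA : size A = 'C(t, k) by rewrite size_subset_prods cU.
have szB : size B = 'C(t, k) by rewrite size_subset_prods cU.
have szs : size s = t by rewrite size_map -cardE cU.
rewrite /e /nb_exceptional; set E := seq.filter _ _.
have Y1 : (0 < Y)%N by rewrite truncn_gt0; have := Q1; lra.
have sP d : d \in s -> prime d /\ (d <= X)%N.
  by case/mapP => i; rewrite mem_enum => iU ->; split; [exact: pU iU | rewrite -ltnS ltn_ord].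
have us : uniq s by rewrite map_inj_uniq ?enum_uniq //; exact: val_inj.
have := @card_missed_le R E A B s X Y m (filter_uniq _ (iota_uniq _ _))
  (subset_prods_uniq k (@pU i0)) (subset_prods_uniq k (@pU i1)).
rewrite szA szB szs !bin_gt0 => /(_ us kt kt t0 sP) main.
rewrite -(ler_nat R) (natrM _ (size E)) (natrM _ _ ((Y ^ 2) ^ m)) !(natrX _ _ m).
rewrite -ler_pdivrMr; last first.
  by rewrite exprn_gt0 // ltr0n expn_gt0 Y1.
rewrite -mulrA -expr_div_n; apply: main => p.
rewrite mem_filter => /andP[/and3P[pr_p /andP[Qp p2Q] exc] _].
have Xkp : (X ^ k <= p)%N by rewrite -(ler_nat R) (le_trans XQ).
split=> //.
- by have := Q1 => ?; rewrite truncn_ge_nat; lra.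
- move=> c; rewrite !mem_cat => /or3P[||].
  + exact: subset_prods_lt.
  + exact: subset_prods_lt.
  + move=> /sP[pr_c cX]; rewrite prime_gt0 //=; apply: leq_ltn_trans cX _.
    by apply: leq_trans Xkp; rewrite -{1}[X]expn1 ltn_exp2l.
- by apply: missed_of_exceptional; rewrite ?Udis.
Qed.

(** This crude count already makes the sieve error [e Y^2] at most of order [Q^3]. *)
Lemma nb_exceptional_le_range : (nb_exceptional alpha delta Q <= (Num.truncn (2 * Q)).+1)%N.
Proof. by rewrite /nb_exceptional size_filter (leq_trans (count_size _ _)) // size_iota. Qed.

End Exceptional.

(** With [y = Q^(eps/2)], the inequality [ln y <= y - 1] gives [t <= c y], and the second factor [y]
    of [Q^eps] absorbs the constant [C]. *)
Lemma log_near_powR (R : realType) (K eps : R) : 0 < eps ->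
  \forall Q \near +oo, forall t : nat, (2 ^ t)%:R <= Q -> K * t.+1%:R <= Q `^ eps.
Proof.
move=> eps0; pose c : R := 2 / (eps * ln 2).
have ln2 : 0 < ln 2 :> R by rewrite ln_gt0 // ltr1n.
pose C := `|K| * (c + 1).
have c0 : 0 < c by rewrite divr_gt0 // mulr_gt0.
near=> Q => t tQ.
have Q1 : 1 <= Q by [].
have Q0 : 0 < Q := lt_le_trans ltr01 Q1.
pose y := Q `^ (eps / 2).
have y1 : 1 <= y.
  have <- : 1 `^ (eps / 2) = 1 :> R by rewrite powR1.
  by apply: ge0_ler_powR => //; rewrite ?nnegrE ltW // divr_gt0.
have yy : Q `^ eps = y * y.
  by rewrite -powRD -?splitr // gt_eqF // implybT.
have ty : t%:R <= c * y.
  have : t%:R * ln 2 <= ln Q.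
    rewrite mulr_natl -lnXn // ler_ln ?posrE ?exprn_gt0 //.
    by rewrite -natrX.
  have : eps / 2 * ln Q <= y.
    rewrite -ln_powR -/y; apply: le_trans (_ : y - 1 <= _); last by rewrite gerBl.
    by rewrite -{1}[y](subrK 1) addrC le_ln1Dx // ltrBrDl addrN (lt_le_trans ltr01).
  move=> h2 h1; rewrite /c mulrAC ler_pdivlMr ?mulr_gt0 //.
  by have := ler_wpM2l (ltW eps0) h1; lra.
apply: le_trans (_ : C * y <= _).
  rewrite /C -mulrA; apply: le_trans (_ : `|K| * t.+1%:R <= _).
    by rewrite ler_wpM2r // ler_norm.
  by rewrite ler_wpM2l // mulrDl mul1r -natr1 lerD.
rewrite yy ler_pM2r ?(lt_le_trans ltr01) //.
(* [C <= y] as soon as [Q >= C^(2/eps)], which holds near infinity. *)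
rewrite -[C](@powRr1 R) ?mulr_ge0 ?addr_ge0 ?(ltW c0) //.
have -> : C `^ 1 = (C `^ (2 / eps)) `^ (eps / 2).
  by rewrite -powRrM; congr (_ `^ _); field; rewrite gt_eqF.
rewrite ge0_ler_powR ?nnegrE ?powR_ge0 ?(ltW Q0) ?divr_ge0 ?(ltW eps0) //.
Unshelve. all: by end_near. Qed.

(** * Choice of the parameters *)

Local Open Scope classical_set_scope.

Theorem theorem1p3 (R : realType) (alpha : R) (halpha : 0 < alpha)
    (delta kappa : R) (hdelta : 0 < delta) (hkappa : 0 < kappa) :
  \forall Q \near +oo, (nb_exceptional alpha delta Q)%:R <= Q `^ kappa.
Proof.
(* This [k] keeps [X <= Q^(1/k)] below both [Q^alpha] and [Q^delta]; a sum of two successors also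
   exceeds 1. *)
have [k [k1 ka kd]] : exists k : nat, [/\ (1 < k)%N, k%:R^-1 <= alpha & k%:R^-1 <= delta].
  exists ((Num.truncn alpha^-1).+1 + (Num.truncn delta^-1).+1)%N.
  split; first by lia.
  - rewrite -[leRHS]invrK lef_pV2 ?posrE ?invr_gt0 ?ltr0n // natrD.
    by rewrite (le_trans (ltW (truncnS_gt _))) // lerDl.
  - rewrite -[leRHS]invrK lef_pV2 ?posrE ?invr_gt0 ?ltr0n // natrD.
    by rewrite (le_trans (ltW (truncnS_gt _))) // lerDr.
(* [K] and [M] are the constant and the exponent of the logarithm in [polylog_bound]. *)
pose m := (5 * k)%N; pose M := ((2 * k + 1) * m)%N.
pose K := (3 * m`! * (2 ^ k * k`!) ^ (2 * m) * (2 ^ k.+1) ^ (2 * m))%N.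
have k0 : 0 < k%:R :> R by rewrite ltr0n ltnW.
have M0 : (0 < M)%N by rewrite /M /m; lia.
have K0 : (0 < K)%N by rewrite !muln_gt0 !expn_gt0 !muln_gt0 !expn_gt0 !fact_gt0.
near=> Q.
have Q1 : 1 <= Q by [].
have Q0 : 0 < Q := lt_le_trans ltr01 Q1.
(* The first estimate makes [X] exceed [12 k L + 1]; the second brings [K (11 L)^M] below
   [Q^kappa]. *)
have logk : forall t : nat, (2 ^ t)%:R <= Q -> (12 * k + 2)%:R * t.+1%:R <= Q `^ k%:R^-1.
  by near: Q; apply: log_near_powR; rewrite invr_gt0.
have logM : forall t : nat, (2 ^ t)%:R <= Q -> (K * 11)%:R * t.+1%:R <= Q `^ (kappa / M%:R).
  by near: Q; apply: log_near_powR; rewrite divr_gt0 // ltr0n.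
pose x := Q `^ k%:R^-1.
have xk : x ^+ k = Q by rewrite -powR_mulrn ?powR_ge0 // -powRrM mulVf ?gt_eqF // powRr1 ?ltW.
have x0 : 0 <= x by apply: powR_ge0.
pose X := Num.truncn x; pose L := (trunc_log 2 X).+1.
have Xx : X%:R <= x by rewrite truncn_le.
have xX : x < X.+1%:R by apply: truncnS_gt.
have x16 : 16 <= x.
  have -> : 16 = (16 ^+ k) `^ k%:R^-1 :> R.
    by rewrite -powR_mulrn // -powRrM mulfV ?gt_eqF // powRr1.
  apply: ge0_ler_powR; rewrite ?nnegrE ?invr_ge0 ?exprn_ge0 ?(ltW Q0) //.
have X16 : (16 <= X)%N by rewrite truncn_ge_nat.
have XQ : (X ^ k)%:R <= Q by rewrite natrX -xk lerXn2r ?nnegrE.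
have X1 : (1 < X)%N := leq_trans (isT : 1 < 16)%N X16.
have log_le : (2 ^ trunc_log 2 X)%:R <= Q.
  apply: le_trans XQ; rewrite ler_nat; apply: leq_trans (_ : X <= _)%N.
    by rewrite trunc_logP // ltnW.
  by rewrite -{1}[X]expn1 leq_exp2l // ltnW.
(* Rounding [x] down leaves [(12k + 2) L <= X]; the spare [2L >= 2] gives the strict inequality. *)
have kX : (12 * k * L + 1 < X)%N.
  have : (12 * k + 2)%:R * L%:R <= x by exact: logk.
  move=> /le_lt_trans /(_ xX); rewrite -natrM ltr_nat.
  rewrite ltnS mulnDl; apply: leq_trans.
  by rewrite -addnS leq_add2l -{1}[2%N]muln1 leq_mul2l.
have [kt Xt] := prime_count_third (ltnW k1) kX.
set t := (_ %/ 3)%N in kt Xt.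
have t0 : (0 < t)%N by rewrite (leq_trans _ kt) // double_gt0 ltnW.
(* Rounding costs at most a factor 2: [x < X + 1 <= 2X], so [2Q = 2 x^k <= 2^(k+1) X^k]. *)
have XY : (Num.truncn (2 * Q) <= 2 ^ k.+1 * X ^ k)%N.
  rewrite -(ler_nat R); apply: (@le_trans _ _ (2 * Q)).
    by rewrite truncn_le mulr_ge0 ?(ltW Q0).
  rewrite expnS -mulnA -expnMn natrM natrX ler_pM2l // -xk lerXn2r ?nnegrE //.
  rewrite (le_trans (ltW xX)) // ler_nat mul2n -addnn -addn1 leq_add2l.
  exact: ltnW.
have main := @nb_exceptional_le R alpha delta Q X k k1 X1 XQ (ltW halpha) (ltW hdelta)
  (le_trans Xx (ler_powR Q1 ka)) (le_trans Xx (ler_powR Q1 kd)) m t0.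
have : (nb_exceptional alpha delta Q <= K * (11 * L) ^ M)%N.
  apply: (@polylog_bound k X (Num.truncn (2 * Q)) L t) => //; first exact: ltnW.
    exact: nb_exceptional_le_range.
  by apply: main; rewrite (leq_trans _ kt) // -addnn leq_addr.
move=> bound; apply: le_trans (_ : (K * (11 * L) ^ M)%:R <= _); first by rewrite ler_nat.
(* Since [K <= K^M], the constant can be moved under the exponent. *)
apply: le_trans (_ : ((K * 11)%:R * L%:R) ^+ M <= _).
  rewrite -natrM -natrX ler_nat -mulnA [in leqRHS]expnMn leq_mul2r; apply/orP; right.
  by rewrite -{1}[K]expn1 leq_pexp2l.
have -> : Q `^ kappa = (Q `^ (kappa / M%:R)) ^+ M.
  by rewrite -powR_mulrn ?powR_ge0 // -powRrM divfK // pnatr_eq0 -lt0n.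
rewrite lerXn2r ?nnegrE ?powR_ge0 ?mulr_ge0 //.
exact: logM.
Unshelve. all: by end_near. Qed.
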